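(* Let $n\ge 1$ and let $A,B$ be $n\times n$ complex Hermitian matrices. Put $H=A+B$, $Q_4=A^4+4A^3B+6A^2B^2+4AB^3+B^4$ and $\operatorname{Re}Q_4=\frac12(Q_4+Q_4^* )$. Then \[ \lambda(H^4)\prec_w \lambda(\operatorname{Re}Q_4), \] and consequently \[ \lambda(H^4)\prec_w \sigma(Q_4). \]
   Context: For an $n\times n$ Hermitian matrix $X$, $\lambda(X)=(\lambda_1(X),\dots,\lambda_n(X))$ is the vector of eigenvalues, counted with multiplicity, in nonincreasing order. For an $n\times n$ complex matrix $Y$, $\sigma(Y)=(\sigma_1(Y),\dots,\sigma_n(Y))$ is the vector of singular values in nonincreasing order. For $x,y\in\mathbb{R}^n$ with entries in nonincreasing order, $x\prec_w y$ ($x$ is weakly majorized by $y$) means $\sum_{i=1}^r x_i\le\sum_{i=1}^r y_i$ for all $r=1,\dots,n$. *)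

(* Defs.v *)
From HB Require Import structures.
From mathcomp Require Import all_boot all_order all_algebra.
From mathcomp Require Import reals.
From mathcomp Require Import complex.

Set Implicit Arguments.
Unset Strict Implicit.
Unset Printing Implicit Defensive.

Import Order.TTheory GRing.Theory Num.Theory.
Local Open Scope ring_scope.
Local Open Scope sesquilinear_scope.
Local Open Scope complex_scope.

(* The roots of the characteristic polynomial, listed with multiplicity. *)
Definition char_roots (R : realType) (n : nat) (X : 'M[R[i]]_n) : seq R[i] :=
  sval (closed_field_poly_normal (char_poly X)).

(* lambda(X). The roots are projected to R by the real part, which loses
   nothing when X is Hermitian: see [eigvals_char_poly]. *)
Definition eigvals (R : realType) (n : nat) (X : 'M[R[i]]_n) : 'rV[R]_n :=
  \row_(i < n) (sort >=%R [seq complex.Re z | z <- char_roots X])`_i.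

(* sigma(Y), the square roots of the eigenvalues of Y^* Y. *)
Definition singvals (R : realType) (n : nat) (Y : 'M[R[i]]_n) : 'rV[R]_n :=
  map_mx Num.sqrt (eigvals (Y^t* *m Y)).

Definition re_mx (R : realType) (n : nat) (Y : 'M[R[i]]_n) : 'M[R[i]]_n :=
  2^-1 *: (Y + Y^t*).

(* Meaningful for x and y with nonincreasing entries. *)
Definition weakly_majorized (R : realType) (n : nat) (x y : 'rV[R]_n) : Prop :=
  forall r : nat, (1 <= r <= n)%N ->
    \sum_(i < n | (i < r)%N) x 0 i <= \sum_(i < n | (i < r)%N) y 0 i.

Lemma char_rootsP (R : realType) (n : nat) (X : 'M[R[i]]_n) :
  char_poly X = \prod_(z <- char_roots X) ('X - z%:P).
Proof.
rewrite /char_roots; case: closed_field_poly_normal => s /= {1}->.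
by rewrite (monicP (char_poly_monic X)) scale1r.
Qed.

Lemma size_char_roots (R : realType) (n : nat) (X : 'M[R[i]]_n) :
  size (char_roots X) = n.
Proof.
by apply: succn_inj; rewrite -(size_prod_XsubC _ id) -char_rootsP size_char_poly.
Qed.

Lemma eigvals_nonincreasing (R : realType) (n : nat) (X : 'M[R[i]]_n)
    (i j : 'I_n) : (i <= j)%N -> eigvals X 0 j <= eigvals X 0 i.
Proof.
move=> le_ij; rewrite !mxE.
have srt : sorted >=%R (sort >=%R [seq complex.Re z | z <- char_roots X]).
  by apply: sort_sorted => x y; exact: le_total.
have ge_trans : transitive (>=%R : rel R) by move=> y x z /[swap]; exact: le_trans.
apply: (sorted_leq_nth ge_trans _ 0 srt) => //; first exact: lexx.
- by rewrite inE size_sort size_map size_char_roots.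
- by rewrite inE size_sort size_map size_char_roots.
Qed.

Lemma char_roots_real (R : realType) (n : nat) (X : 'M[R[i]]_n) (z : R[i]) :
  X \is hermsymmx -> z \in char_roots X -> (complex.Re z)%:C = z.
Proof.
move=> hX; rewrite -root_prod_XsubC -char_rootsP -eigenvalue_root_char.
case/eigenvalueP => v vX vn0.
have dv0 : dotmx v v != 0 by rewrite gt_eqF ?dotmx_is_dotmx.
have XE : X^t* = X.
  by rewrite [RHS](is_hermitianmxP _ _ _ hX) expr0 scale1r.
have : z * dotmx v v = Num.conj z * dotmx v v.
  have -> : z * dotmx v v = dotmx (v *m X) v.
    by rewrite !dotmxE vX -scalemxAl [RHS]mxE.
  have -> : Num.conj z * dotmx v v = dotmx v (v *m X).
    by rewrite !dotmxE vX linearZ /= map_mxZ -scalemxAr [RHS]mxE.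
  by rewrite !dotmxE trmx_mul map_mxM /= XE mulmxA.
move/(mulIf dv0) => zE; apply/esym/eqP; rewrite RRe_real //.
by apply/CrealP; rewrite -zE.
Qed.

Lemma eigvals_char_poly (R : realType) (n : nat) (X : 'M[R[i]]_n) :
  X \is hermsymmx ->
  char_poly X = \prod_(i < n) ('X - ((eigvals X 0 i)%:C)%:P).
Proof.
move=> hX; pose s := sort >=%R [seq complex.Re z | z <- char_roots X].
have sn : size s = n by rewrite size_sort size_map size_char_roots.
transitivity (\prod_(x <- s) ('X - (x%:C)%:P)).
  rewrite char_rootsP (perm_big [seq complex.Re z | z <- char_roots X]) /=.
    by rewrite big_map; apply: eq_big_seq => z /(char_roots_real hX) ->.
  by rewrite perm_sort.
rewrite (big_nth 0) big_mkord sn.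
by apply: eq_bigr => i _; rewrite mxE.
Qed.

(* Main.v *)
Require Import Defs.
From mathcomp Require Import all_boot all_order all_algebra.
From mathcomp Require Import reals.
From mathcomp Require Import complex.
From mathcomp Require Import all_fingroup.
From mathcomp Require Import ring lra zify.

(* In an orthonormal eigenbasis of H, with eigenvalues h_i ordered so that h_i^4
   is nonincreasing, the recursion Q_{k+1} = A Q_k + Q_k B = Q_k H + [A, Q_k]
   gives for the diagonal entries of Re Q_4 the formula
     h_i^4 + sum_k |a_ik|^2 (h_i - h_k) (5 h_i + 3 h_k).
   Summed over i < r, the second term is nonnegative: the pairs i, k < r
   symmetrize to 2 (h_i - h_k)^2, and (h_i - h_k) (5 h_i + 3 h_k) >= 0 as soon as
   |h_k| <= |h_i|. The first majorization follows from Ky Fan's maximum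
   principle, the second from lambda_i(Re Y) <= sigma_i(Y) (Fan-Hoffman). *)

Set Implicit Arguments.
Unset Strict Implicit.
Unset Printing Implicit Defensive.

Import Order.TTheory GRing.Theory Num.Theory.
Local Open Scope ring_scope.
Local Open Scope sesquilinear_scope.

Local Notation Re := complex.Re.

(** * Squared moduli, adjoints and unitary similarity *)

Definition normsq (R : realType) (z : R[i]) : R := Re z ^+ 2 + complex.Im z ^+ 2.

Lemma normsq_ge0 (R : realType) (z : R[i]) : 0 <= normsq z.
Proof. by rewrite addr_ge0 ?sqr_ge0. Qed.

Lemma normsq_eq0 (R : realType) (z : R[i]) : (normsq z == 0) = (z == 0).
Proof. by rewrite /normsq paddr_eq0 ?sqr_ge0 // !sqrf_eq0 eq_complex. Qed.

Lemma mul_conj_normsq (R : realType) (z : R[i]) : z * z^* = (normsq z)%:C%C.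
Proof. by rewrite -normCK add_Re2_Im2. Qed.

Lemma normsq_conj (R : realType) (z : R[i]) : normsq z^* = normsq z.
Proof. by apply: complexI; rewrite -!mul_conj_normsq conjCK mulrC. Qed.

Lemma Re_realM (R : realType) (x : R) (z : R[i]) : Re (x%:C%C * z) = x * Re z.
Proof. by case: z => a b /=; rewrite mul0r subr0. Qed.

Section Adjoint.

Variables (C : numClosedFieldType).

Lemma adjmxM m n p (A : 'M[C]_(m, n)) (B : 'M[C]_(n, p)) :
  (A *m B)^t* = B^t* *m A^t*.
Proof. by rewrite trmx_mul map_mxM. Qed.

Lemma adjmxD m n (A B : 'M[C]_(m, n)) : (A + B)^t* = A^t* + B^t*.
Proof. by rewrite linearD /= map_mxD. Qed.

Lemma hermsymmxP n (A : 'M[C]_n) : reflect (A^t* = A) (A \is hermsymmx).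
Proof. by apply: (iffP (is_hermitianmxP _ _ _)); rewrite expr0 scale1r. Qed.

Lemma unitarymx_mulVmx n (U : 'M[C]_n) : U \is unitarymx -> U^t* *m U = 1%:M.
Proof. by rewrite -trmxC_unitary => /unitarymxP; rewrite trmxCK. Qed.

End Adjoint.

Lemma char_poly_similar (R : comNzRingType) n (U V X : 'M[R]_n) :
  V *m U = 1%:M -> char_poly (V *m X *m U) = char_poly X.
Proof.
move=> VU.
have pVU : map_mx polyC V *m map_mx polyC U = 1%:M by rewrite -map_mxM VU map_mx1.
have -> : char_poly (V *m X *m U)
    = \det (map_mx polyC V *m char_poly_mx X *m map_mx polyC U).
  rewrite /char_poly /char_poly_mx !map_mxM mulmxBr mulmxBl.
  by rewrite scalar_mxC -(mulmxA 'X%:M) pVU mulmx1.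
by rewrite !det_mulmx mulrAC -det_mulmx pVU det1 mul1r.
Qed.

Lemma perm_mx_unitary (C : numClosedFieldType) n (s : {perm 'I_n}) :
  perm_mx s \is @unitarymx C n n.
Proof.
by apply/unitarymxP; rewrite tr_perm_mx map_perm_mx -perm_mxM mulgV perm_mx1.
Qed.

(** * Unitary diagonalization with real, ordered eigenvalues *)

Section Spectral.

Variable R : realType.
Local Notation Rdiag d := (diag_mx (map_mx (real_complex R) d)).

Lemma hermsymmx_unitary_diag n (X : 'M[R[i]]_n) : X \is hermsymmx ->
  exists U : 'M_n, exists2 d : 'rV[R]_n,
    U \is unitarymx & X = U^t* *m Rdiag d *m U.
Proof.
move=> hX; have /orthomx_spectralP := hermitian_normalmx hX.
have := hermitian_spectral_diag_real hX; have := spectral_unitarymx X.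
move: (spectralmx X) (spectral_diag X) => U d Uu /mxOverP d_real XE.
exists U, (map_mx (@complex.Re R) d); first exact: Uu.
have -> : map_mx (real_complex R) (map_mx (@complex.Re R) d) = d.
  by apply/rowP => j; rewrite 2!mxE RRe_real.
by rewrite -(invmx_unitary Uu).
Qed.

Lemma sorting_perm n (f : 'I_n -> R) :
  exists s : {perm 'I_n}, forall i j : 'I_n, (i <= j)%N -> f (s j) <= f (s i).
Proof.
pose r i j := f j <= f i.
have r_trans : transitive r by move=> y x z /[swap]; exact: le_trans.
have r_total : total r by move=> x y; exact: le_total.
have : perm_eq (sort r (enum 'I_n)) (ord_tuple n) by rewrite perm_sort val_ord_tuple.
case/tuple_permP => s Es; exists s => i j le_ij.
have sz : size (sort r (enum 'I_n)) = n by rewrite size_sort size_enum_ord.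
have nthE (k : 'I_n) : nth i (sort r (enum 'I_n)) k = s k.
  by rewrite Es (nth_map i) ?size_enum_ord // tnth_ord_tuple nth_ord_enum.
rewrite -!nthE.
have srt : sorted r (sort r (enum 'I_n)) by exact: sort_sorted.
by apply: (sorted_leq_nth r_trans _ i srt); rewrite ?inE ?sz // => x; exact: lexx.
Qed.

(** The sorting key [f] is a parameter because two orders are needed: [id] gives the order of
    [eigvals], and the fourth power gives the order in which [H ^+ 4] has a nonincreasing
    spectrum. *)
Lemma hermsymmx_unitary_diag_sorted n (X : 'M[R[i]]_n) (f : R -> R) :
  X \is hermsymmx ->
  exists U : 'M_n, exists d : 'rV[R]_n,
    [/\ U \is unitarymx, X = U^t* *m Rdiag d *m U
      & forall i j : 'I_n, (i <= j)%N -> f (d 0 j) <= f (d 0 i)].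
Proof.
move=> /hermsymmx_unitary_diag[U [d Uu ->]].
have [s f_s] := sorting_perm (fun i => f (d 0 i)).
exists (row_perm s U), (col_perm s d); split.
- by rewrite row_permE mul_unitarymx ?perm_mx_unitary.
- have -> : Rdiag (col_perm s d) = perm_mx s *m Rdiag d *m (perm_mx s)^t*.
    rewrite tr_perm_mx map_perm_mx -row_permE -col_permE.
    by apply/matrixP=> i j; rewrite !mxE (inj_eq perm_inj).
  by rewrite row_permE adjmxM !mulmxA !mulmxKtV ?perm_mx_unitary.
- by move=> i j /f_s; rewrite !mxE.
Qed.

Lemma diag_real_adj n (d : 'rV[R]_n) : (Rdiag d)^t* = Rdiag d.
Proof.
rewrite tr_diag_mx map_diag_mx -map_mx_comp; congr diag_mx.
by apply/rowP => j; rewrite !mxE; exact: conjc_real.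
Qed.

Lemma diag_real_exp n (d : 'rV[R]_n) k :
  (Rdiag d) ^+ k = Rdiag (\row_j d 0 j ^+ k).
Proof.
elim: k => [|k IHk]; first by rewrite expr0; apply/matrixP => i j; rewrite !mxE.
rewrite exprS IHk -mulmxE mul_diag_mx; apply/matrixP => i j; rewrite !mxE.
by rewrite exprS rmorphM mulrnAr.
Qed.

Lemma unitary_diag_hermsymmx n (U : 'M[R[i]]_n) (d : 'rV[R]_n) :
  U^t* *m Rdiag d *m U \is hermsymmx.
Proof. by apply/hermsymmxP; rewrite !adjmxM diag_real_adj trmxCK mulmxA. Qed.

(** The characteristic polynomial determines the multiset of its roots, and a multiset has only one
    nonincreasing listing. *)
Lemma eigvals_unitary_diag n (U : 'M[R[i]]_n) (d : 'rV[R]_n) :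
    U \is unitarymx -> (forall i j : 'I_n, (i <= j)%N -> d 0 j <= d 0 i) ->
  eigvals (U^t* *m Rdiag d *m U) = d.
Proof.
move=> Uu d_anti; set X := _ *m _ *m _.
have hX : X \is hermsymmx by exact: unitary_diag_hermsymmx.
pose s (e : 'rV[R]_n) := [seq e 0 i | i <- enum 'I_n].
have sE (e : 'rV[R]_n) : \prod_(i < n) ('X - ((e 0 i)%:C%C)%:P)
    = \prod_(z <- [seq x%:C%C | x <- s e]) ('X - z%:P) :> {poly R[i]}.
  by rewrite 2!big_map big_enum.
have : perm_eq (s (eigvals X)) (s d).
  apply: (@perm_map_inj _ _ (real_complex R)); first exact: complexI.
  apply: prod_XsubC_eq; rewrite -!sE -eigvals_char_poly //.
  rewrite char_poly_similar ?unitarymx_mulVmx // char_poly_trig ?diag_mx_is_trig //.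
  by apply: eq_bigr => i _; rewrite !mxE eqxx mulr1n.
have r_trans : transitive (>=%R : rel R) by move=> y x z /[swap]; exact: le_trans.
have srt (e : 'rV[R]_n) : (forall i j : 'I_n, (i <= j)%N -> e 0 j <= e 0 i) ->
    sorted >=%R (s e).
  move=> e_anti; rewrite sorted_map; apply: (@sub_sorted _ (relpre val leq)).
    by move=> i j; exact: e_anti.
  by rewrite -sorted_map val_enum_ord iota_sorted.
move/(sorted_eq r_trans ge_anti (srt _ (@eigvals_nonincreasing _ _ X)) (srt _ d_anti)).
by move/eq_in_map => Es; apply/rowP => i; apply: Es; rewrite mem_enum.
Qed.

Lemma hermsymmx_eigvals n (X : 'M[R[i]]_n) : X \is hermsymmx ->
  exists2 U : 'M_n, U \is unitarymx & X = U^t* *m Rdiag (eigvals X) *m U.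
Proof.
move=> /hermsymmx_unitary_diag_sorted - /(_ id)[U [d [Uu XE d_anti]]].
exists U; first exact: Uu.
by have := eigvals_unitary_diag Uu d_anti; rewrite -XE => ->.
Qed.

(** * Ky Fan's maximum principle *)

Lemma quad_diag_entry m n (W : 'M[R[i]]_(m, n)) (d : 'rV[R]_n) (i : 'I_m) :
  (W *m Rdiag d *m W^t*) i i = (\sum_k normsq (W i k) * d 0 k)%:C%C.
Proof.
rewrite mul_mx_diag mxE rmorph_sum; apply: eq_bigr => k _.
by rewrite !mxE mulrAC mul_conj_normsq rmorphM.
Qed.

Lemma mx_adj_entry m n (W : 'M[R[i]]_(m, n)) (i : 'I_m) :
  (W *m W^t*) i i = (\sum_k normsq (W i k))%:C%C.
Proof.
by rewrite mxE rmorph_sum; apply: eq_bigr => k _; rewrite !mxE mul_conj_normsq.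
Qed.

Lemma unitarymx_row_normsq n (W : 'M[R[i]]_n) (i : 'I_n) : W \is unitarymx ->
  \sum_k normsq (W i k) = 1.
Proof.
by move=> /unitarymxP Wu; apply: complexI; rewrite -mx_adj_entry Wu mxE eqxx.
Qed.

Lemma unitarymx_col_normsq n (W : 'M[R[i]]_n) (k : 'I_n) : W \is unitarymx ->
  \sum_i normsq (W i k) = 1.
Proof.
rewrite -trmxC_unitary => /unitarymx_row_normsq => /(_ k) <-.
by apply: eq_bigr => i _; rewrite !mxE normsq_conj.
Qed.

(** Moving weight towards the largest entries only increases the sum. Both weightings have total
    mass [r], so [d] may be shifted by a threshold [c]; then the difference of the two sums is
    nonnegative term by term. *)
Lemma sum_weights_le n (r : nat) (w d : 'I_n -> R) : (1 <= r <= n)%N ->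
    (forall i j : 'I_n, (i <= j)%N -> d j <= d i) ->
    (forall k, 0 <= w k <= 1) -> \sum_k w k = \sum_(k < n | (k < r)%N) 1 ->
  \sum_k w k * d k <= \sum_(k < n | (k < r)%N) d k.
Proof.
case: r => // r le_rn d_anti w01 sum_w.
rewrite [leRHS]big_mkcond; rewrite [RHS]big_mkcond in sum_w.
(* After the case split [r] is one less than the number of entries kept, so [c] is the last, hence
   smallest, of them. *)
pose c := d (Ordinal le_rn).
have zero : \sum_(k < n) ((if (k < r.+1)%N then 1 else 0) - w k) = 0.
  by rewrite sumrB sum_w subrr.
rewrite -subr_ge0 -sumrB.
have -> : \sum_(k < n) ((if (k < r.+1)%N then d k else 0) - w k * d k)
    = \sum_(k < n) ((if (k < r.+1)%N then 1 else 0) - w k) * (d k - c).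
  under [RHS]eq_bigr do rewrite mulrBr.
  rewrite [RHS]sumrB -mulr_suml zero mul0r subr0.
  apply: eq_bigr => k _; case: ifP => _; ring.
apply: sumr_ge0 => k _; case/andP: (w01 k) => w0 w1; case: ltnP => [le_kr | lt_rk].
  by rewrite mulr_ge0 ?subr_ge0 // d_anti.
by rewrite sub0r mulNr -mulrN mulr_ge0 // opprB subr_ge0 d_anti //= ltnW.
Qed.

(** In an eigenbasis of [X] the diagonal entries become averages of eigenvalues with weights
    [normsq (W i k)]. Since [W] is unitary, summing these over [i < r] gives weights in [0, 1] of
    total mass [r]. *)
Lemma Ky_Fan n (r : nat) (X U : 'M[R[i]]_n) : (1 <= r <= n)%N ->
    X \is hermsymmx -> U \is unitarymx ->
  \sum_(i < n | (i < r)%N) Re ((U *m X *m U^t*) i i)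
    <= \sum_(i < n | (i < r)%N) eigvals X 0 i.
Proof.
move=> r_n /hermsymmx_eigvals[V Vu {1}->] Uu; pose W := U *m V^t*.
have Wu : W \is unitarymx by rewrite mul_unitarymx ?trmxC_unitary.
have -> : U *m (V^t* *m Rdiag (eigvals X) *m V) *m U^t*
    = W *m Rdiag (eigvals X) *m W^t*.
  by rewrite adjmxM trmxCK !mulmxA.
under eq_bigr do rewrite quad_diag_entry /=.
rewrite exchange_big /=; under eq_bigr do rewrite -mulr_suml.
apply: sum_weights_le => //; first by move=> i j; exact: eigvals_nonincreasing.
  move=> k; rewrite sumr_ge0 => [|i _]; last exact: normsq_ge0.
  rewrite -(unitarymx_col_normsq k Wu) big_mkcond ler_sum // => i _.
  by case: ifP => // _; exact: normsq_ge0.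
by rewrite exchange_big /=; apply: eq_bigr => i _; rewrite unitarymx_row_normsq.
Qed.

(** * Hermitian parts, singular values and the Fan-Hoffman inequality *)

Lemma hermsymmx_adj_mul n (Y : 'M[R[i]]_n) : Y^t* *m Y \is hermsymmx.
Proof. by apply/hermsymmxP; rewrite adjmxM trmxCK. Qed.

Lemma re_mx_hermsymmx n (Y : 'M[R[i]]_n) : re_mx Y \is hermsymmx.
Proof.
apply/hermsymmxP; rewrite /re_mx linearZ /= map_mxZ adjmxD trmxCK addrC.
by rewrite rmorphV ?unitfE ?pnatr_eq0 // rmorph_nat.
Qed.

Lemma re_mxE n (Y : 'M[R[i]]_n) : Y + Y^t* = 2 *: re_mx Y.
Proof. by rewrite /re_mx scalerA divff ?scale1r // pnatr_eq0. Qed.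

(** Dimension count: the first condition cuts out a space of dimension [i + 1], the second one of
    dimension at least [n - i], and these add up to more than [n]. *)
Lemma flag_intersection n (W : 'M[R[i]]_n) (i : 'I_n) :
  exists2 y : 'rV[R[i]]_n, y != 0 &
    (forall k : 'I_n, (i < k)%N -> y 0 k = 0) /\
    (forall k : 'I_n, (k < i)%N -> (y *m W) 0 k = 0).
Proof.
pose P : 'M[R[i]]_n := pid_mx i.+1; pose Q : 'M[R[i]]_n := W *m pid_mx i.
have rkP : \rank P = i.+1 by rewrite rank_pid_mx.
have rkQ : (\rank Q <= i)%N.
  by rewrite (leq_trans (mxrankM_maxr _ _)) // rank_pid_mx // ltnW.
have rk : (0 < \rank (P :&: kermx Q))%N.
  have := mxrank_sum_cap P (kermx Q); rewrite rkP mxrank_ker.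
  have := rank_leq_col (P + kermx Q)%MS; have := ltn_ord i; lia.
pose y := nz_row (P :&: kermx Q)%MS.
have y0 : y != 0 by rewrite nz_row_eq0 -mxrank_eq0 -lt0n.
exists y => //.
have [yP yQ] : (y <= P)%MS /\ (y <= kermx Q)%MS.
  by apply/andP; rewrite -sub_capmx nz_row_sub.
split=> k lt_k.
  case/submxP: yP => D ->; rewrite mxE big1 // => j _.
  by rewrite mxE; case: eqP => [->|_]; rewrite ?ltnS 1?leqNgt ?lt_k ?mulr0.
have /rowP /(_ k) := sub_kermxP yQ; rewrite /Q mulmxA !mxE (bigD1 k) //= big1.
  by rewrite !mxE eqxx lt_k mulr1 addr0.
move=> j jk; rewrite [pid_mx _ _ _]mxE (_ : (j == k :> nat) = false) ?mulr0 //.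
exact/negbTE.
Qed.

Lemma quadratic_form_re_mx n (Y : 'M[R[i]]_n) (x : 'rV[R[i]]_n) (N t : R) :
    (x *m x^t*) 0 0 = N%:C%C ->
  0 <= t ^+ 2 * N - 2 * t * Re ((x *m re_mx Y *m x^t*) 0 0)
       + Re ((x *m (Y^t* *m Y) *m x^t*) 0 0).
Proof.
(* The expression is the squared norm of [t x - x Y^*]. *)
move=> xE; pose w := t%:C%C *: x - x *m Y^t*.
have : 0 <= Re ((w *m w^t*) 0 0).
  by rewrite mx_adj_entry sumr_ge0 // => k _; exact: normsq_ge0.
have -> : w *m w^t* = (t ^+ 2)%:C%C *: (x *m x^t*)
    - (2 * t)%:C%C *: (x *m re_mx Y *m x^t*) + x *m (Y^t* *m Y) *m x^t*.
  have -> : w^t* = t%:C%C *: x^t* - Y *m x^t*.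
    rewrite /w linearB /= map_mxB adjmxM trmxCK linearZ /= map_mxZ.
    by congr (_ *: _ - _); exact: conjc_real.
  have -> : (2 * t)%:C%C = t%:C%C * 2 by rewrite mulrC rmorphM /= rmorph_nat.
  rewrite -scalerA.
  have -> : 2 *: (x *m re_mx Y *m x^t*) = x *m (Y + Y^t*) *m x^t*.
    by rewrite re_mxE -[in RHS]scalemxAr -[in RHS]scalemxAl.
  rewrite /w mulmxBl !mulmxBr mulmxDr mulmxDl scalerDr -!scalemxAl -!scalemxAr scalerA.
  rewrite -expr2 -rmorphXn opprB opprD !mulmxA.
  by rewrite -!addrA; congr (_ + (_ + _)); rewrite addrC.
move: (x *m x^t*) xE (x *m re_mx Y *m x^t*) (x *m (Y^t* *m Y) *m x^t*) => M xE P S.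
by rewrite !mxE xE !raddfD raddfN /= !Re_realM mul0r subr0.
Qed.

(** If [t] exceeded the root, then [t > 0] and [s < t ^+ 2], so the quadratic would be at most
    [(s - t ^+ 2) * N < 0]. *)
Lemma le_sqrt_of_quadratic (N a b s t : R) :
    0 < N -> t * N <= a -> b <= s * N -> 0 <= t ^+ 2 * N - 2 * t * a + b ->
  t <= Num.sqrt s.
Proof.
move=> N_gt0 hi lo quad; rewrite leNgt; apply/negP => lt_st.
have t_gt0 : 0 < t by exact: le_lt_trans (sqrtr_ge0 _) lt_st.
have lt_st2 : s < t ^+ 2.
  (* For negative [s], [Num.sqrt s] is 0 by convention and the bound is immediate. *)
  have [s0|s0] := ltP s 0; first by rewrite (lt_le_trans s0) ?sqr_ge0.
  by rewrite -(sqr_sqrtr s0) ltr_pXn2r // nnegrE ?sqrtr_ge0 ?ltW.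
nra.
Qed.

(** A single test vector [x] compares both spectra: it lies in the span of the leading eigenvectors
    of [re_mx Y] up to index [i], and is orthogonal to those of [Y^t* *m Y] of index below [i]. *)
Lemma Fan_Hoffman n (Y : 'M[R[i]]_n) (i : 'I_n) :
  eigvals (re_mx Y) 0 i <= singvals Y 0 i.
Proof.
have [U Uu XE] := hermsymmx_eigvals (re_mx_hermsymmx Y).
have [V Vu ZE] := hermsymmx_eigvals (hermsymmx_adj_mul Y).
rewrite [leRHS]mxE.
set l := eigvals (re_mx Y) in XE *; set m := eigvals _ in ZE *.
(* [U *m V^t*] changes coordinates between the two eigenbases: [y] and [z] are the coordinates of
   [x] for [re_mx Y] and for [Y^t* *m Y], and [N] is its squared norm. *)
have [y y0 [y_hi y_lo]] := flag_intersection (U *m V^t*) i.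
pose x := y *m U; pose z := x *m V^t*; pose N := \sum_k normsq (y 0 k).
have xE : (x *m x^t*) 0 0 = N%:C%C.
  rewrite /x adjmxM !mulmxA -(mulmxA y) (unitarymxP Uu) mulmx1.
  exact: mx_adj_entry.
have NE : N = \sum_k normsq (z 0 k).
  apply: complexI; rewrite -xE -mx_adj_entry /z (adjmxM x) trmxCK !mulmxA.
  by rewrite mulmxKtV.
have N_gt0 : 0 < N.
  rewrite lt_def sumr_ge0 ?andbT => [|k _]; last exact: normsq_ge0.
  apply: contra y0 => /eqP N0; apply/eqP/rowP => k; rewrite mxE.
  apply/eqP; rewrite -normsq_eq0; apply/eqP.
  by apply: (psumr_eq0P _ N0) => // j _; exact: normsq_ge0.
have hi : l 0 i * N <= Re ((x *m re_mx Y *m x^t*) 0 0).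
  have -> : x *m re_mx Y *m x^t* = y *m Rdiag l *m y^t*.
    rewrite XE /x adjmxM !mulmxA -(mulmxA y) (unitarymxP Uu) mulmx1.
    by rewrite -(mulmxA _ U) (unitarymxP Uu) mulmx1.
  rewrite quad_diag_entry /= mulrC mulr_suml ler_sum // => k _.
  have [le_ki|/y_hi ->] := leqP k i; last by rewrite /normsq /= expr0n /= addr0 !mul0r.
  by rewrite ler_wpM2l ?normsq_ge0 // eigvals_nonincreasing.
have lo : Re ((x *m (Y^t* *m Y) *m x^t*) 0 0) <= m 0 i * N.
  have -> : x *m (Y^t* *m Y) *m x^t* = z *m Rdiag m *m z^t*.
    by rewrite ZE /z (adjmxM x) trmxCK !mulmxA.
  rewrite quad_diag_entry /= NE [leRHS]mulrC mulr_suml ler_sum // => k _.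
  have [le_ik|/y_lo zk] := leqP i k.
    by rewrite ler_wpM2l ?normsq_ge0 // eigvals_nonincreasing.
  by rewrite /z /x -mulmxA zk /normsq /= expr0n /= addr0 !mul0r.
apply: le_sqrt_of_quadratic N_gt0 hi lo _.
exact: quadratic_form_re_mx.
Qed.

(** * Diagonal entries of the ordered quartic *)

Definition ordered_step n (A B Q : 'M[R[i]]_n) : 'M[R[i]]_n := A *m Q + Q *m B.

(** Multiplying by [A] on the left and [B] on the right keeps every [A] before every [B], so the
    coefficients obey Pascal's rule. Starting from degree 1, three steps reach degree 4. *)
Lemma ordered_quartic n (A B : 'M[R[i]]_n) :
  A ^+ 4 + 4 *: (A ^+ 3 *m B) + 6 *: (A ^+ 2 *m B ^+ 2) + 4 *: (A *m B ^+ 3) + B ^+ 4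
    = iter 3 (ordered_step A B) (A + B).
Proof.
rewrite /= /ordered_step !exprS !expr0 !mulr1 !mulmxE.
rewrite !(mulrDl, mulrDr) !mulrA.
move: (A * A * A * A) (A * A * A * B) (A * A * B * B) (A * B * B * B) (B * B * B * B).
move=> w0 w1 w2 w3 w4; apply/matrixP => i j; rewrite !mxE; ring.
Qed.

(** For diagonal [D] the first term only rescales columns; all noncommutativity sits in the
    commutator with [A]. *)
Lemma ordered_step_comm n (A D Q : 'M[R[i]]_n) :
  ordered_step A (D - A) Q = Q *m D + (A *m Q - Q *m A).
Proof. by rewrite /ordered_step mulmxBr addrCA. Qed.

Lemma commutator_adj n (A X : 'M[R[i]]_n) :
  (A *m X - X *m A)^t* = X^t* *m A^t* - A^t* *m X^t*.
Proof. by rewrite linearB /= map_mxB !adjmxM. Qed.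

Lemma re_diag_ordered_quartic n (A B : 'M[R[i]]_n) (h : 'rV[R]_n) (i : 'I_n) :
    A^t* = A -> A + B = Rdiag h ->
  Re ((A ^+ 4 + 4 *: (A ^+ 3 *m B) + 6 *: (A ^+ 2 *m B ^+ 2)
       + 4 *: (A *m B ^+ 3) + B ^+ 4) i i)
    = h 0 i ^+ 4
      + \sum_k normsq (A i k) * ((h 0 i - h 0 k) * (5 * h 0 i + 3 * h 0 k)).
Proof.
move=> hA HD; rewrite ordered_quartic HD.
have -> : B = Rdiag h - A by rewrite -HD addrC addKr.
set D := Rdiag h; pose c k : R[i] := (h 0 k)%:C%C.
pose K := \matrix_(j, k) (A j k * (c k - c j)); pose L := A *m K - K *m A.
have KE : K = A *m D - D *m A.
  by apply/matrixP => j k; rewrite mul_mx_diag mul_diag_mx !mxE /c; ring.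
have AE j k : A k j = (A j k)^* by rewrite -{1}hA !mxE.
have Q2E : ordered_step A (D - A) D = D *m D + K by rewrite ordered_step_comm KE.
(* [M] is [K *m D] plus the commutator of [A] with [D *m D]; its factor comes from (c_k - c_j) c_k +
   c_k^2 - c_j^2. *)
pose M := \matrix_(j, k) (A j k * ((c k - c j) * (2 * c k + c j))).
have Q3E : ordered_step A (D - A) (D *m D + K) = D *m D *m D + M + L.
  have ME : M = K *m D + (A *m (D *m D) - D *m D *m A).
    by apply/matrixP => j k; rewrite mulmx_diag !mul_mx_diag mul_diag_mx !mxE /c; ring.
  rewrite ordered_step_comm ME /L !(mulmxDl, mulmxDr) opprD.
  by rewrite (addrACA (A *m (D *m D))) !addrA.
rewrite /= Q2E Q3E ordered_step_comm.
have K_adj : K^t* = - K.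
  by rewrite KE commutator_adj hA diag_real_adj opprB.
have L_adj : L^t* = L.
  by rewrite /L commutator_adj hA K_adj mulmxN mulNmx opprK addrC.
(* [A L - L A] is skew-Hermitian, hence has an imaginary diagonal. *)
have AL : Re ((A *m L - L *m A) i i) = 0.
  have -> : L *m A = (A *m L)^t* by rewrite adjmxM hA L_adj.
  by rewrite !mxE; case: (\sum_j _) => a b /=; rewrite subrr.
(* [K] and [M] are entrywise multiples of [A] by real factors. In the commutator with [A], each
   diagonal term pairs [A i k] with its conjugate [A k i], leaving a squared modulus. *)
have comm_diag (g : 'I_n -> 'I_n -> R) (X : 'M_n) :
    (forall j k, X j k = A j k * (g j k)%:C%C) ->
  (A *m X - X *m A) i i = (\sum_k normsq (A i k) * (g k i - g i k))%:C%C.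
  move=> XE; rewrite [LHS]mxE [X in _ + X]mxE ![(_ *m _) i i]mxE -sumrB rmorph_sum.
  apply: eq_bigr => k _; rewrite !XE [A k i]AE rmorphM rmorphB /= -mul_conj_normsq.
  by ring.
have LE : L i i = (\sum_k normsq (A i k) * (2 * (h 0 i - h 0 k)))%:C%C.
  rewrite (comm_diag (fun j k => h 0 k - h 0 j)) => [|j k]; last by rewrite mxE rmorphB.
  by congr (_%:C%C); apply: eq_bigr => k _; ring.
have ME : (A *m M - M *m A) i i
    = (\sum_k normsq (A i k) * ((h 0 i - h 0 k) * (3 * h 0 i + 3 * h 0 k)))%:C%C.
  rewrite (comm_diag (fun j k => (h 0 k - h 0 j) * (2 * h 0 k + h 0 j))) => [|j k].
    by congr (_%:C%C); apply: eq_bigr => k _; ring.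
  by rewrite mxE rmorphM rmorphB rmorphD rmorphM rmorph_nat.
have DE : (A *m (D *m D *m D) - D *m D *m D *m A) i i = 0.
  by rewrite !mulmx_diag mul_mx_diag mul_diag_mx !mxE; ring.
have comm3 (X Y Z : 'M_n) :
    ((X + Y + Z) *m D + (A *m (X + Y + Z) - (X + Y + Z) *m A)) i i
    = (X i i + Y i i + Z i i) * c i + ((A *m X - X *m A) i i
      + (A *m Y - Y *m A) i i + (A *m Z - Z *m A) i i).
  rewrite mxE mul_mx_diag; congr (_ + _); first by rewrite !mxE.
  have -> : A *m (X + Y + Z) - (X + Y + Z) *m A
      = (A *m X - X *m A) + (A *m Y - Y *m A) + (A *m Z - Z *m A).
    by rewrite !(mulmxDl, mulmxDr) !opprD (addrACA _ (A *m Z)) (addrACA _ (A *m Y)).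
  by rewrite [LHS]mxE [X in X + _]mxE.
have D3E : (D *m D *m D) i i = c i ^+ 3.
  by rewrite !mulmx_diag !mxE eqxx mulr1n /c; ring.
have Mii : M i i = 0 by rewrite mxE subrr mul0r mulr0.
have ReD (z : R) (w : R[i]) : Re (z%:C%C + w) = z + Re w by case: w.
have diagE x y : (c i ^+ 3 + 0 + x%:C%C) * c i + (0 + y%:C%C)
    = ((h 0 i ^+ 3 + x) * h 0 i + y)%:C%C.
  by rewrite addr0 add0r rmorphD rmorphM rmorphD rmorphXn.
rewrite comm3 DE ME D3E Mii LE addrA diagE ReD AL.
(* The factor 5 h_i + 3 h_k splits as 2 h_i, from the diagonal of [L] times [D], plus 3 h_i + 3 h_k,
   from the commutator of [A] with [M]. *)
have -> : \sum_k normsq (A i k) * ((h 0 i - h 0 k) * (5 * h 0 i + 3 * h 0 k))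
    = (\sum_k normsq (A i k) * (2 * (h 0 i - h 0 k))) * h 0 i
      + \sum_k normsq (A i k) * ((h 0 i - h 0 k) * (3 * h 0 i + 3 * h 0 k)).
  by rewrite mulr_suml -big_split; apply: eq_bigr => k _ /=; ring.
ring.
Qed.

(** * Nonnegativity of the excess over the leading indices *)

Lemma sum_exchange_excess_ge0 n (r : nat) (c : 'I_n -> 'I_n -> R) (h : 'I_n -> R) :
    (forall i j, 0 <= c i j) -> (forall i j, c i j = c j i) ->
    (forall i j : 'I_n, (i <= j)%N -> h j ^+ 4 <= h i ^+ 4) ->
  0 <= \sum_(i < n | (i < r)%N)
         \sum_k c i k * ((h i - h k) * (5 * h i + 3 * h k)).
Proof.
move=> c_ge0 c_sym h_anti.
(* The second summand of [g] is antisymmetric, hence cancels over [i, k < r]. *)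
pose g i k := (h i - h k) ^+ 2 + 4 * (h i ^+ 2 - h k ^+ 2).
have -> : \sum_(i < n | (i < r)%N) \sum_k c i k * ((h i - h k) * (5 * h i + 3 * h k))
    = \sum_(i < n | (i < r)%N) \sum_(k < n | (k < r)%N) c i k * g i k
      + \sum_(i < n | (i < r)%N) \sum_(k < n | ~~ (k < r)%N) c i k * g i k.
  rewrite -big_split; apply: eq_bigr => i _ /=.
  rewrite (bigID (fun k : 'I_n => (k < r)%N)) /=.
  by congr (_ + _); apply: eq_bigr => k _; rewrite /g; ring.
apply: addr_ge0; last first.
  (* Here [i < r <= k], so the order of the fourth powers gives [h k ^+ 2 <= h i ^+ 2] and both
     summands of [g] are nonnegative. *)
  apply: sumr_ge0 => i lt_ir; apply: sumr_ge0 => k; rewrite -leqNgt => le_rk.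
  rewrite mulr_ge0 // addr_ge0 ?sqr_ge0 // mulr_ge0 // subr_ge0.
  rewrite -(@ler_pXn2r _ 2) ?nnegrE ?sqr_ge0 // -!exprM.
  by apply: h_anti; rewrite ltnW // (leq_trans lt_ir).
(* The double sum is added to its copy with [i] and [k] exchanged; by symmetry of [c] each pair
   contributes [c i k] times 2 (h_i - h_k)^2. *)
rewrite -(@pmulr_rge0 _ 2) // mulr_natl mulr2n {2}exchange_big -big_split.
apply: sumr_ge0 => i _; rewrite -big_split; apply: sumr_ge0 => k _ /=.
rewrite (c_sym k i) -mulrDr mulr_ge0 // /g.
by have := sqr_ge0 (h i - h k); nra.
Qed.

(** * Passage to an eigenbasis of [H] and the two majorizations *)

Lemma unitary_conjM n (U X Y : 'M[R[i]]_n) : U \is unitarymx ->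
  U *m (X *m Y) *m U^t* = (U *m X *m U^t*) *m (U *m Y *m U^t*).
Proof. by move=> Uu; rewrite !mulmxA mulmxKtV. Qed.

Lemma unitary_conjX n (U X : 'M[R[i]]_n) k : U \is unitarymx ->
  U *m (X ^+ k) *m U^t* = (U *m X *m U^t*) ^+ k.
Proof.
move=> Uu; elim: k => [|k IHk]; first by rewrite !expr0 mulmx1 (unitarymxP Uu).
by rewrite !exprS -IHk -!mulmxE -unitary_conjM.
Qed.

Lemma Re_diag_re_mx n (Y : 'M[R[i]]_n) (i : 'I_n) : Re (re_mx Y i i) = Re (Y i i).
Proof.
rewrite !mxE; have -> : Y i i + (Y i i)^* = 2 * (Re (Y i i))%:C%C by exact: addcJ.
by rewrite mulKf ?pnatr_eq0.
Qed.

Lemma unitary_conj_re_mx n (U Y : 'M[R[i]]_n) :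
  U *m re_mx Y *m U^t* = re_mx (U *m Y *m U^t*).
Proof.
rewrite /re_mx -scalemxAr -scalemxAl mulmxDr mulmxDl; congr (_ *: (_ + _)).
by rewrite !adjmxM trmxCK mulmxA.
Qed.

End Spectral.

Unset Implicit Arguments.
Set Strict Implicit.

Theorem theorem4p3 (R : realType) (n : nat) (A B : 'M[R[i]]_n)
    (n_ge1 : (1 <= n)%N)
    (hermA : A \is hermsymmx) (hermB : B \is hermsymmx) :
  let H := A + B in
  let Q4 := A ^+ 4 + 4 *: (A ^+ 3 *m B) + 6 *: (A ^+ 2 *m B ^+ 2)
            + 4 *: (A *m B ^+ 3) + B ^+ 4 in
  weakly_majorized (eigvals (H ^+ 4)) (eigvals (re_mx Q4)) /\
  weakly_majorized (eigvals (H ^+ 4)) (singvals Q4).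
Proof.
move=> H Q4.
suff major : weakly_majorized (eigvals (H ^+ 4)) (eigvals (re_mx Q4)).
  split=> // r r_n; apply: (le_trans (major r r_n)); apply: ler_sum => i _.
  exact: Fan_Hoffman.
move=> r r_n.
have hermH : H \is hermsymmx.
  by apply/hermsymmxP; rewrite adjmxD (hermsymmxP _ hermA) (hermsymmxP _ hermB).
(* The eigenvalues of [H] may be negative, so they are ordered by fourth power to match
   [eigvals (H ^+ 4)]. *)
have [U [h [Uu HE h4_anti]]] := hermsymmx_unitary_diag_sorted (fun x => x ^+ 4) hermH.
have H4E : H ^+ 4 = U^t* *m diag_mx (map_mx (real_complex R) (\row_j h 0 j ^+ 4)) *m U.
  rewrite HE -{2}(trmxCK U) -unitary_conjX ?trmxC_unitary // trmxCK.
  by rewrite diag_real_exp.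
pose A' := U *m A *m U^t*; pose B' := U *m B *m U^t*.
have A'B' : A' + B' = diag_mx (map_mx (real_complex R) h).
  rewrite -mulmxDl -mulmxDr -/H HE !mulmxA (unitarymxP Uu) mul1mx.
  by rewrite -mulmxA (unitarymxP Uu) mulmx1.
have A'_adj : A'^t* = A' by rewrite !adjmxM trmxCK (hermsymmxP _ hermA) mulmxA.
have Q4E : U *m Q4 *m U^t* = A' ^+ 4 + 4 *: (A' ^+ 3 *m B') + 6 *: (A' ^+ 2 *m B' ^+ 2)
    + 4 *: (A' *m B' ^+ 3) + B' ^+ 4.
  rewrite /A' /B' -!unitary_conjX // -!unitary_conjM // /Q4.
  by rewrite !(mulmxDr, mulmxDl) -!(scalemxAr, scalemxAl).
(* The trial basis in Ky Fan's principle is the eigenbasis of [H]; it remains to compare h_i^4 with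
   the diagonal of the conjugated [re_mx Q4]. *)
apply: le_trans (Ky_Fan r_n (re_mx_hermsymmx Q4) Uu).
rewrite H4E eigvals_unitary_diag // => [|i j le_ij]; last by rewrite !mxE h4_anti.
rewrite -subr_ge0 -sumrB.
under eq_bigr => i _.
  rewrite unitary_conj_re_mx Re_diag_re_mx Q4E (re_diag_ordered_quartic _ A'_adj A'B').
  rewrite mxE addrC addKr.
  over.
apply: sum_exchange_excess_ge0 => // [i j|i j]; first exact: normsq_ge0.
by rewrite -[in LHS]A'_adj !mxE normsq_conj.
Qed.
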